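(* Let $\ell,(\theta_k),p,\tau,(\lambda_k)$ satisfy the standing assumptions listed in the context, and let $\vartheta^i_k,\alpha_i,\beta_i,S_i,\widehat S_i,\chi_i$ be as defined there. Assume that for each $i\in\{0,\dots,\ell\}$ and each $t\in[\theta_0,\infty)$: $t\in S_i$ if and only if $\tau(t)\in\widehat S_i$. Assume that there are functions $\sigma_i:[\theta_0,\infty)\to[\vartheta^i_{-1},\infty)$ ($i\in\{0,\dots,\ell\}$) such that $\alpha_i(\sigma_i(t))=\tau(\alpha_i(t))$ for all $t\in[\theta_0,\infty)$ and $\sigma_i(\beta_i(t))=\beta_i(\tau(t))$ for all $t\in S_i$. Let $\varphi\in AC([\rho_{\theta_0},\theta_0],\mathbb R)$. Consider the impulsive problem $$x'(t)+p(t)x(\tau(t))=0\ (t\ge\theta_0,\ t\notin\{\theta_k\}),\quad x(\theta_k)=\lambda_kx(\theta_{k-\ell}^-)\ (k\in\mathbb N_0),\quad x=\varphi\text{ on }[\rho_{\theta_0},\theta_0), \tag{I}$$ and, for $i\in\{0,\dots,\ell\}$, the nonimpulsive problem $$y_i'(t)+\Big[\prod_{j\in\mathbb N_0,\ \sigma_i(t)<\vartheta^i_j\le t}\frac1{\lambda_{j(\ell+1)+i}}\Big]p(\alpha_i(t))\,y_i(\sigma_i(t))=0\ \text{ for a.e. }t\ge\theta_0,\qquad y_i(t)=\varphi(\alpha_i(t))\ \text{ for }t\in[\vartheta^i_{-1},\theta_0). \tag{N$_i$}$$ Then: (i) If $x$ is a solution of (I), then for each $i\in\{0,\dots,\ell\}$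 the function $$y_i(t):=\Big[\prod_{j\in\mathbb N_0,\ \vartheta^i_j\le t}\frac1{\lambda_{j(\ell+1)+i}}\Big]x(\alpha_i(t)),\qquad t\in[\vartheta^i_{-1},\infty),$$ is a solution of (N$_i$). (ii) If $y_i$ is a solution of (N$_i$) for each $i\in\{0,\dots,\ell\}$, then the function $x$ with $x=\varphi$ on $[\rho_{\theta_0},\theta_0)$ and $$x(t):=\sum_{\mu=0}^{\ell}\chi_\mu(t)\Big[\prod_{j\in\mathbb N_0,\ \theta_{j(\ell+1)+\mu}\le t}\lambda_{j(\ell+1)+\mu}\Big]y_\mu(\beta_\mu(t)),\qquad t\in[\theta_0,\infty),$$ is a solution of (I).
   Context: Conventions: $\mathbb N=\{1,2,\dots\}$, $\mathbb N_0=\mathbb N\cup\{0\}$; empty products are $1$, empty sums are $0$; $f(a^\pm)$ are one-sided limits; absolutely continuous on an unbounded interval means absolutely continuous on each compact subinterval; $AC([a,b],\mathbb R)$ is the set of absolutely continuous real functions on $[a,b]$. Standing assumptions: $\ell\in\mathbb N_0$; $\theta_{-\ell}<\theta_{-\ell+1}<\dots<\theta_0<\theta_1<\cdots$ are reals with $\theta_k\to\infty$; $p:[\theta_0,\infty)\to\mathbb R$ is Lebesgue measurable and locally essentially bounded; $\tau:[\theta_0,\infty)\to\mathbb R$ is Lebesgue measurable, $\tau(t)\le t$ for all $t$, $\lim_{t\to\infty}\tau(t)=\infty$; $(\lambda_k)_{k\in\mathbb N_0}$ are nonzero reals. Put $\rho_t:=\inf\{\tau(\xi):\xi\ge t\}$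 (finite) and $\theta_{-(\ell+1)}:=\rho_{\theta_0}$, where $\rho_{\theta_0}<\theta_{-\ell}$. Solution of the impulsive problem (I): a function $x:[\rho_{\theta_0},\infty)\to\mathbb R$ such that for every $k\in\mathbb N_0$ $x$ is absolutely continuous on $[\theta_k,\theta_{k+1})$, and both one-sided limits of $x$ exist at $\theta_k$ with $x(\theta_k)=x(\theta_k^+)$; $x=\varphi$ on $[\rho_{\theta_0},\theta_0)$; $x'(t)+p(t)x(\tau(t))=0$ for almost every $t\in[\theta_0,\infty)$; and $x(\theta_k)=\lambda_kx(\theta_{k-\ell}^-)$ for all $k\in\mathbb N_0$. Time changes. For $i\in\{0,\dots,\ell\}$: $\vartheta^i_{-1}:=\theta_0-[\theta_{-(\ell+1)+i+1}-\theta_{-(\ell+1)+i}]$, $\vartheta^i_0:=\theta_0$, $\vartheta^i_k:=\vartheta^i_{k-1}+\theta_{(k-1)(\ell+1)+i+1}-\theta_{(k-1)(\ell+1)+i}$ for $k\in\mathbb N$; it is assumed that $\vartheta^i_k\to\infty$ as $k\to\infty$ for each $i$. Let $S_i:=\bigcup_{\nu\in\mathbb N_0}[\theta_{\nu(\ell+1)+i},\theta_{\nu(\ell+1)+i+1})$ and $\widehat S_i:=\bigcup_{\nu\in\mathbb N_0}[\theta_{(\nu-1)(\ell+1)+i},\theta_{(\nu-1)(\ell+1)+i+1})$, and let $\chi_i$ be the characteristic function of $\widehat S_i$ (on $[\theta_0,\infty)$ it is the characteristic function of $S_i$). $\alpha_i:[\vartheta^i_{-1},\infty)\to\widehat S_i$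 is $$\alpha_i(t)=t+[\theta_i-\theta_0]+\sum_{j\in\mathbb N,\ \theta_0<\vartheta^i_j\le t}[\theta_{j(\ell+1)+i}-\theta_{(j-1)(\ell+1)+i+1}]\ (t\ge\theta_0),\qquad \alpha_i(t)=t-[\theta_0-\theta_{-(\ell+1)+i+1}]\ (\vartheta^i_{-1}\le t<\theta_0);$$ it maps $[\vartheta^i_{k-1},\vartheta^i_k)$ onto $[\theta_{(k-1)(\ell+1)+i},\theta_{(k-1)(\ell+1)+i+1})$ for each $k\in\mathbb N_0$. $\beta_i:\widehat S_i\to[\vartheta^i_{-1},\infty)$ is the inverse of $\alpha_i$: $$\beta_i(t)=t-\Big\{[\theta_i-\theta_0]+\sum_{j\in\mathbb N,\ \theta_{j(\ell+1)+i}\le t}[\theta_{j(\ell+1)+i}-\theta_{(j-1)(\ell+1)+i+1}]\Big\}\ (t\in S_i),\qquad \beta_i(t)=t+[\theta_0-\theta_{-(\ell+1)+i+1}]\ (t\in[\theta_{-(\ell+1)+i},\theta_{-(\ell+1)+i+1})).$$ In sums $\sum_\mu\chi_\mu(t)\cdots$, terms with $\chi_\mu(t)=0$ are read as $0$. A solution of (N$_i$) is a function $y_i$ that is absolutely continuous on $[\vartheta^i_{-1},\infty)$ and satisfies the equation a.e. and the initial condition (so $y_i(\theta_0)=\lim_{t\to\theta_0^-}\varphi(\alpha_i(t))$). *)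

(* Defs.v *)
(* MathComp-Analysis. *)
From HB Require Import structures.
From mathcomp Require Import all_boot all_order all_algebra.
From mathcomp Require Import all_classical all_reals all_analysis.
From mathcomp Require Import measurable_realfun.

Set Implicit Arguments.
Unset Strict Implicit.
Unset Printing Implicit Defensive.

Import Order.TTheory GRing.Theory Num.Theory.
Import numFieldNormedType.Exports.

Local Open Scope classical_set_scope.
Local Open Scope ring_scope.

(* A function on an interval I is a total function R -> R of which only the
   values on I are used. *)

(* The measurable sets of the source are the Lebesgue measurable ones (Borel
   sets up to null sets), whereas those of measurableTypeR are Borel sets. *)
Definition lebesgue_measurable_fun (R : realType) (D : set R) (f : R -> R) :=
  @measurable_fun _ _
    (g_sigma_algebraType (completed_algebra_gen (@lebesgue_measure R)))
    (measurableTypeR R) D f.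

Definition loc_ess_bounded (R : realType) (D : set R) (f : R -> R) :=
  forall a b : R, `[a, b] `<=` D ->
    exists M : R, \forall t \ae (@lebesgue_measure R),
      `[a, b]%classic t -> `|f t| <= M.

(* D is meant to be an interval. *)
Definition abs_continuous (R : realType) (D : set R) (f : R -> R) :=
  forall e : R, 0 < e -> exists2 d : R, 0 < d &
    forall (n : nat) (a b : 'I_n -> R),
      (forall i, [/\ D (a i), D (b i) & a i <= b i]) ->
      trivIset setT (fun i => `]a i, b i[%classic) ->
      \sum_(i < n) (b i - a i) < d ->
      \sum_(i < n) `|f (b i) - f (a i)| < e.

(* The meaning of absolute continuity on an unbounded interval. *)
Definition loc_abs_continuous (R : realType) (D : set R) (f : R -> R) :=
  forall a b : R, `[a, b] `<=` D -> abs_continuous `[a, b] f.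

Definition rho (R : realType) (tau : R -> R) (t : R) : R :=
  inf [set tau xi | xi in `[t, +oo[].

(* The index n (l + 1) + i. *)
Definition idx (l : nat) (n : int) (i : nat) : int := n * (l.+1)%:Z + i%:Z.

Section TimeChange.
Context (R : realType) (l : nat) (theta : int -> R).

(* vtheta i k is the k-th shifted impulse time for k >= 0; the one of index -1
   is vtheta_m1 i. *)
Fixpoint vtheta (i k : nat) : R :=
  if k is k'.+1
  then vtheta i k' + (theta (idx l k'%:Z i + 1) - theta (idx l k'%:Z i))
  else theta 0.

Definition vtheta_m1 (i : nat) : R :=
  theta 0 - (theta (idx l (-1) i + 1) - theta (idx l (-1) i)).

Definition S_ (i : nat) : set R :=
  \bigcup_(nu : nat) `[theta (idx l nu%:Z i), theta (idx l nu%:Z i + 1)[%classic.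

Definition Shat (i : nat) : set R :=
  \bigcup_(nu : nat)
    `[theta (idx l (nu%:Z - 1) i), theta (idx l (nu%:Z - 1) i + 1)[%classic.

Definition chi (i : nat) : R -> R := \1_(Shat i).

(* The index sets of the sums and products below are finite as soon as
   vtheta i k and theta k tend to +oo; otherwise \sum_(j \in A) and its
   multiplicative analogue would return a default value. *)
Definition alpha (i : nat) (t : R) : R :=
  if theta 0 <= t then
    t + (theta i%:Z - theta 0)
    + \sum_(j \in [set j : nat | (0 < j)%N /\ theta 0 < vtheta i j <= t])
        (theta (idx l j%:Z i) - theta (idx l (j%:Z - 1) i + 1))
  else t - (theta 0 - theta (idx l (-1) i + 1)).

(* Only meaningful on Shat i. *)
Definition beta (i : nat) (t : R) : R :=
  if t \in S_ i then
    t - ((theta i%:Z - theta 0)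
         + \sum_(j \in [set j : nat | (0 < j)%N /\ theta (idx l j%:Z i) <= t])
             (theta (idx l j%:Z i) - theta (idx l (j%:Z - 1) i + 1)))
  else t + (theta 0 - theta (idx l (-1) i + 1)).

End TimeChange.

Definition is_solution_I (R : realType) (l : nat) (theta : int -> R)
    (p tau : R -> R) (lambda : nat -> R) (phi : R -> R) (x : R -> R) : Prop :=
  [/\ forall k : nat,
        [/\ abs_continuous `[theta k%:Z, theta (k%:Z + 1)[ x,
            cvg (x @ (theta k%:Z)^'-) &
            x @ (theta k%:Z)^'+ --> x (theta k%:Z)],
      forall t, rho tau (theta 0) <= t < theta 0 -> x t = phi t,
      \forall t \ae (@lebesgue_measure R), theta 0 <= t ->
        derivable x t 1 /\ derive1 x t + p t * x (tau t) = 0 &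
      forall k : nat,
        x (theta k%:Z) =
          lambda k * lim (x @ (theta (k%:Z - l%:Z))^'-)].

Definition is_solution_N (R : realType) (l : nat) (theta : int -> R)
    (p : R -> R) (lambda : nat -> R) (phi : R -> R) (sigma : nat -> R -> R)
    (i : nat) (y : R -> R) : Prop :=
  [/\ loc_abs_continuous `[vtheta_m1 l theta i, +oo[ y,
      \forall t \ae (@lebesgue_measure R), theta 0 <= t ->
        derivable y t 1 /\
        derive1 y t
        + (\big[*%R/1]_(j \in [set j : nat | sigma i t < vtheta l theta i j <= t])
             (1 / lambda (j * l.+1 + i)%N))
          * p (alpha l theta i t) * y (sigma i t) = 0 &
      forall t, vtheta_m1 l theta i <= t < theta 0 ->
        y t = phi (alpha l theta i t)].

(* Main.v *)
(* Gluing the pieces [theta_(k(l+1)+i), theta_(k(l+1)+i+1)[ of one residue class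
   i end to end, the left limit at theta_(k-l) that drives the impulse at theta_k
   becomes the left limit at the very same glued point. Dividing x by the product
   of the factors lambda met so far hence removes the jumps, and on each piece x
   and y_i differ only by a translation and a constant factor. Since S_i is
   tau-invariant, the delayed value sits in the same class i, so the ratio of the
   constants of the two pieces involved is the product of the 1 / lambda_j in
   (N_i). *)
Require Import Defs.
From HB Require Import structures.
From mathcomp Require Import all_boot all_order all_algebra.
From mathcomp Require Import all_classical all_reals all_analysis.
From mathcomp Require Import measurable_realfun.
From mathcomp Require Import ring lra zify.

Set Implicit Arguments.
Unset Strict Implicit.
Unset Printing Implicit Defensive.

Import Order.TTheory GRing.Theory Num.Theory.
Import numFieldNormedType.Exports.

Local Open Scope classical_set_scope.
Local Open Scope ring_scope.

(** * Absolute continuity: affine transport, concatenation, extension to an endpoint *)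

Section AbsContinuous.
Context (R : realType).
Implicit Types (D E : set R) (f g : R -> R).

(** The increments of [g] are [c] times those of [f] over translated intervals, whose lengths and
    disjointness are unchanged. This carries absolute continuity between a piece of [x] and the
    matching piece of [y]. *)
Lemma abs_continuous_affine D E f g (c d : R) :
  (forall t, E t -> D (t + d) /\ g t = c * f (t + d)) ->
  abs_continuous D f -> abs_continuous E g.
Proof.
move=> Eg fac e e0.
(* Dividing by [|c| + 1] instead of [|c|] avoids a separate case for [c = 0]. *)
have c1 : 0 < `|c| + 1 by rewrite ltr_wpDl.
have [del del0 H] := fac _ (divr_gt0 e0 c1).
exists del => // n a b abE tab sab.
have := H n (fun i => a i + d) (fun i => b i + d).
have abD i : [/\ D (a i + d), D (b i + d) & a i + d <= b i + d].
  have [Ea Eb ab] := abE i.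
  by split; [exact: (Eg _ Ea).1|exact: (Eg _ Eb).1|rewrite lerD2r].
have tabd : trivIset [set: 'I_n] (fun i => `]a i + d, b i + d[%classic).
  move=> i j _ _ [z [/= zi zj]]; apply: (tab i j I I).
  by exists (z - d); split; move: zi zj; rewrite /= !in_itv/= => /andP[? ?] /andP[? ?];
    apply/andP; split; lra.
move=> /(_ abD tabd).
have -> : \sum_(i < n) (b i + d - (a i + d)) = \sum_(i < n) (b i - a i).
  by apply: eq_bigr => i _; ring.
move=> /(_ sab) Hs.
have -> : \sum_(i < n) `|g (b i) - g (a i)|
          = `|c| * \sum_(i < n) `|f (b i + d) - f (a i + d)|.
  rewrite mulr_sumr; apply: eq_bigr => i _; have [Ea Eb _] := abE i.
  by rewrite (Eg _ Ea).2 (Eg _ Eb).2 -mulrBr normrM.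
move: Hs; rewrite ltr_pdivlMr// mulrC; apply: le_lt_trans.
by apply: ler_wpM2r; [exact: sumr_ge0|rewrite lerDl].
Qed.

Lemma abs_continuousS D E f : E `<=` D -> abs_continuous D f -> abs_continuous E f.
Proof.
move=> ED; apply: (@abs_continuous_affine _ _ _ _ 1 0) => t Et.
by rewrite addr0 mul1r; split => //; exact: ED.
Qed.

Lemma abs_continuous_dist D f e : abs_continuous D f -> 0 < e ->
  exists2 d : R, 0 < d &
    forall s t, D s -> D t -> `|t - s| < d -> `|f t - f s| < e.
Proof.
move=> fac e0; have [d d0 H] := fac _ e0; exists d => // s t.
wlog st : s t / s <= t.
  move=> W Ds Dt; have [st|/ltW ts] := leP s t; first exact: W.
  by rewrite distrC (distrC (f t)); exact: W.
move=> Ds Dt; rewrite ger0_norm ?subr_ge0// => std.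
have := H 1 (fun=> s) (fun=> t); rewrite !big_ord1; apply => //.
by move=> i j _ _ _; rewrite !ord1.
Qed.

Lemma abs_continuous_cvg_left D f (a b : R) : a < b -> `[a, b] `<=` D ->
  abs_continuous D f -> f x @[x --> b^'-] --> f b.
Proof.
move=> ab abD fac; apply/cvgrPdist_lt => e e0.
have [d d0 H] := abs_continuous_dist fac e0.
near=> t; apply: H.
- apply: abD => /=; rewrite in_itv/=; apply/andP; split.
    by near: t; exact: nbhs_left_ge.
  by near: t; exact: nbhs_left_le.
- by apply: abD => /=; rewrite in_itv/= lexx ltW.
- rewrite ger0_norm; last by rewrite subr_ge0; near: t; exact: nbhs_left_le.
  by near: t; exact: nbhs_left_ltBl.
Unshelve. all: by end_near. Qed.

Lemma abs_continuous_cvg_right D f (a b : R) : a < b -> `[a, b[ `<=` D ->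
  abs_continuous D f -> f x @[x --> a^'+] --> f a.
Proof.
move=> ab abD fac; apply/cvgrPdist_lt => e e0.
have [d d0 H] := abs_continuous_dist fac e0.
near=> t; rewrite distrC; apply: H.
- by apply: abD => /=; rewrite in_itv/= lexx.
- apply: abD => /=; rewrite in_itv/=; apply/andP; split.
    by near: t; exact: nbhs_right_ge.
  by near: t; exact: nbhs_right_lt.
- rewrite ger0_norm; last by rewrite subr_ge0; near: t; exact: nbhs_right_ge.
  by near: t; exact: nbhs_right_ltDr.
Unshelve. all: by end_near. Qed.

(* Clipping a disjoint family of intervals at [c], from above and from below,
   gives two disjoint families on which the increments of [f] add up. *)
Lemma sum_dist_cut f (c : R) n (a b : 'I_n -> R) :
  (forall i, a i <= b i) ->
  \sum_(i < n) `|f (b i) - f (a i)| <=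
    \sum_(i < n) `|f (Num.min (b i) c) - f (Num.min (a i) c)| +
    \sum_(i < n) `|f (Num.max (b i) c) - f (Num.max (a i) c)|.
Proof.
move=> ab; rewrite -big_split /=; apply: ler_sum => i _.
have [bc|cb] := leP (b i) c.
  by rewrite (min_l (le_trans (ab i) bc)) lerDl.
have [ac|ca] := leP (a i) c; last first.
  by rewrite subrr normr0 add0r.
by rewrite addrC; apply: le_trans (ler_normD _ _); rewrite subrKA.
Qed.

(** A clipped interval is empty or contained in the original one, so common points are inherited. *)
Lemma trivIset_min (c : R) n (a b : 'I_n -> R) :
  trivIset setT (fun i => `]a i, b i[%classic) ->
  trivIset setT (fun i => `]Num.min (a i) c, Num.min (b i) c[%classic).
Proof.
move=> tab i j _ _ [z [/= zi zj]]; apply: (tab i j I I); exists z.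
split; [move: zi|move: zj]; rewrite /= !in_itv/=.
  by case: (leP (a i) c); case: (leP (b i) c) => ? ? /andP[? ?]; apply/andP; split; lra.
by case: (leP (a j) c); case: (leP (b j) c) => ? ? /andP[? ?]; apply/andP; split; lra.
Qed.

Lemma trivIset_max (c : R) n (a b : 'I_n -> R) :
  trivIset setT (fun i => `]a i, b i[%classic) ->
  trivIset setT (fun i => `]Num.max (a i) c, Num.max (b i) c[%classic).
Proof.
move=> tab i j _ _ [z [/= zi zj]]; apply: (tab i j I I); exists z.
split; [move: zi|move: zj]; rewrite /= !in_itv/=.
  by case: (leP (a i) c); case: (leP (b i) c) => ? ? /andP[? ?]; apply/andP; split; lra.
by case: (leP (a j) c); case: (leP (b j) c) => ? ? /andP[? ?]; apply/andP; split; lra.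
Qed.

Lemma sum_min_le (c : R) n (a b : 'I_n -> R) : (forall i, a i <= b i) ->
  \sum_(i < n) (Num.min (b i) c - Num.min (a i) c) <= \sum_(i < n) (b i - a i).
Proof.
move=> ab; apply: ler_sum => i _; have := ab i.
by case: (leP (b i) c); case: (leP (a i) c); lra.
Qed.

Lemma sum_max_le (c : R) n (a b : 'I_n -> R) : (forall i, a i <= b i) ->
  \sum_(i < n) (Num.max (b i) c - Num.max (a i) c) <= \sum_(i < n) (b i - a i).
Proof.
move=> ab; apply: ler_sum => i _; have := ab i.
by case: (leP (b i) c); case: (leP (a i) c); lra.
Qed.

Lemma abs_continuous_concat f (a b c : R) : a <= c -> c <= b ->
  abs_continuous `[a, c] f -> abs_continuous `[c, b] f ->
  abs_continuous `[a, b] f.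
Proof.
move=> ac cb f1 f2 e e0.
have e20 : 0 < e / 2 by rewrite divr_gt0.
have [d1 d10 H1] := f1 _ e20; have [d2 d20 H2] := f2 _ e20.
exists (Num.min d1 d2); first by rewrite lt_min d10.
move=> n p q pqD tpq; rewrite lt_min => /andP[s1 s2].
have pq i : p i <= q i by have [] := pqD i.
apply: le_lt_trans (sum_dist_cut f c pq) _.
rewrite (splitr e); apply: ltrD.
- apply: H1.
  + move=> i; have [] := pqD i; rewrite /= !in_itv/= => /andP[? ?] /andP[? ?] ?.
    by case: (leP (q i) c); case: (leP (p i) c); split; lra.
  + exact: trivIset_min.
  + exact: le_lt_trans (sum_min_le _ pq) s1.
- apply: H2.
  + move=> i; have [] := pqD i; rewrite /= !in_itv/= => /andP[? ?] /andP[? ?] ?.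
    by case: (leP (q i) c); case: (leP (p i) c); split; lra.
  + exact: trivIset_max.
  + exact: le_lt_trans (sum_max_le _ pq) s2.
Qed.

(** Cut at a point [s < c]: the parts below [s] are controlled on the half-open interval, the parts
    above by the oscillation of [f] near [c]. Since [d] is fixed before the family of intervals, [s]
    may depend on their number [n]. *)
Lemma abs_continuous_closure f (a c : R) : a < c ->
  abs_continuous `[a, c[ f -> f x @[x --> c^'-] --> f c ->
  abs_continuous `[a, c] f.
Proof.
move=> ac fac fc e e0.
have [d d0 H] := fac _ (divr_gt0 e0 (ltr0Sn _ 1)); exists d => //.
move=> n p q pqD tpq spq.
have pq i : p i <= q i by have [] := pqD i.
(* Each of the [n] increments above the cut is at most [2 * eta], so they sum to less than [e / 2];
   [n.+1] makes this strict and covers [n = 0]. *)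
pose eta := e / 4 / n.+1%:R.
have eta0 : 0 < eta by rewrite !divr_gt0.
have [r r0 Hr] : exists2 r : R, 0 < r &
    forall t, c - r < t <= c -> `|f c - f t| < eta.
  have /cvgrPdist_lt/(_ _ eta0)[r /= r0 Hr] := fc.
  exists r => // t /andP[rt]; rewrite le_eqVlt => /predU1P[->|tc].
    by rewrite subrr normr0.
  by apply: Hr => //=; rewrite gtr0_norm; lra.
pose s := Num.max a (c - r / 2).
have [as_ sc rs] : [/\ a <= s, s < c & c - r < s].
  by rewrite /s; case: (leP a (c - r / 2)) => ?; split; lra.
apply: le_lt_trans (sum_dist_cut f s pq) _.
rewrite (splitr e); apply: ltrD.
- apply: H.
  + move=> i; have [] := pqD i; rewrite /= !in_itv/= => /andP[? ?] /andP[? ?] ?.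
    by case: (leP (q i) s); case: (leP (p i) s); split; lra.
  + exact: trivIset_min.
  + exact: le_lt_trans (sum_min_le _ pq) spq.
- apply: (@le_lt_trans _ _ (\sum_(i < n) (eta + eta))).
    apply: ler_sum => i _.
    have [] := pqD i; rewrite /= !in_itv/= => /andP[? ?] /andP[? ?] ?.
    rewrite (_ : f _ - f _ = (f c - f (Num.max (p i) s))
                             - (f c - f (Num.max (q i) s))); last by ring.
    apply: le_trans (ler_normB _ _) _; apply: lerD; apply/ltW/Hr.
      by case: (leP (p i) s); lra.
    by case: (leP (q i) s); lra.
  rewrite sumr_const card_ord -[(_ + _) *+ n]mulr_natr /eta.
  have n0 : (0 : R) < n.+1%:R by [].
  rewrite (_ : e / 2 = (e / 4 / n.+1%:R + e / 4 / n.+1%:R) * n.+1%:R).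
    by rewrite ltr_pM2l ?ltr_nat// addr_gt0// !divr_gt0.
  by field; rewrite gt_eqF.
Qed.
End AbsContinuous.

(** * Null sets, derivatives and left limits under translations; location of a point among
    consecutive times *)

Lemma ae_translate (R : realType) (P : R -> Prop) (d : R) :
  (\forall t \ae (@lebesgue_measure R), P t) ->
  \forall t \ae (@lebesgue_measure R), P (t + d).
Proof.
case=> A [mA A0 PA].
pose f : R -> measurableTypeR R := fun t => t + d.
have mT : measurable_fun [set: R] f by exact: measurable_funD.
have mfA : measurable (f @^-1` A) by rewrite -[X in measurable X]setTI; exact: mT.
exists (f @^-1` A); split => //; last by move=> t /= nP; exact: PA.
rewrite -A0; apply/esym.
(* The image of Lebesgue measure under the translation agrees with it on half-open intervals, which
   determine the measure. *)
apply: (@lebesgue_measure_unique R (pushforward (@lebesgue_measure R) f)) => //.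
move=> _ [[a b]] _ <-; rewrite /pushforward/=.
have fab : f @^-1` `]a, b] = `]a - d, b - d]%classic.
  by apply/seteqP; split => t /=; rewrite /f !in_itv/= lerBrDr ltrBlDr.
rewrite [X in _ = lebesgue_measure X]fab !lebesgue_measure_itv/= !lte_fin ltrD2r.
by case: ifP => // _; rewrite -!EFinB; congr EFin; ring.
Qed.

Lemma derive1_affine (R : realType) (f g : R -> R) (c d t : R) :
  (\forall s \near t, g s = c * f (s + d)) -> derivable f (t + d) 1 ->
  derivable g t 1 /\ derive1 g t = c * derive1 f (t + d).
Proof.
move=> gf df.
have Hf : is_derive (t + d) 1 f (derive1 f (t + d)).
  by apply: DeriveDef => //; rewrite derive1E.
have Hs : is_derive t 1 (shift d : R -> R) 1 by exact: is_derive_shift.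
have Hg : is_derive t 1 g (c * derive1 f (t + d)).
  apply: (@near_eq_is_derive _ _ _ (fun s => c * (f \o shift d) s)).
    by near=> s; apply/esym; near: s.
  have H := @is_derive1_comp _ f (shift d) t _ _ Hf Hs.
  rewrite mulr1 in H.
  exact: is_deriveZ.
by split; [exact: ex_derive|rewrite derive1E; exact: derive_val].
Unshelve. all: by end_near. Qed.

Lemma cvg_left_affine (R : realType) (f g : R -> R) (a b c d l : R) : a < b ->
  (forall s, a <= s < b -> g s = c * f (s + d)) ->
  f x @[x --> (b + d)^'-] --> l -> g x @[x --> b^'-] --> c * l.
Proof.
move=> ab gf fl.
apply: (@cvg_trans _ (c * f (x + d) @[x --> b^'-])).
  apply: near_eq_cvg; near=> s; apply/esym/gf/andP; split.
    by near: s; exact: nbhs_left_ge.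
  by near: s; exact: nbhs_left_lt.
apply: cvgMr.
apply/cvgrPdist_lt => e e0; move/cvgrPdist_lt : fl => /(_ _ e0)[r /= r0 H].
exists r => //= s; rewrite /ball_/= => bs sb; apply: H; last by rewrite ltrD2r.
by rewrite /ball_/= (_ : b + d - (s + d) = b - s)//; ring.
Unshelve. all: by end_near. Qed.

Lemma fsbig_I (R : comNzRingType) (A : set nat) (n : nat) (F : nat -> R) :
  A = `I_n -> \big[*%R/1]_(j \in A) F j = \prod_(j < n) F j.
Proof. by move=> ->; rewrite fsbig_ord. Qed.

(** Away from its left endpoint a half-open piece is a neighbourhood, so formulas valid on it can be
    differentiated; the countably many endpoints form a null set. *)
Lemma near_itvco (R : realType) (a b t : R) : a <= t < b -> t != a ->
  \forall s \near t, a <= s < b.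
Proof.
move=> /andP[at_ tb] ta.
have at' : a < t by rewrite lt_neqAle eq_sym ta.
by near=> s; apply/andP; split; [apply/ltW|]; near: s; [exact: lt_nbhsr|exact: lt_nbhsl].
Unshelve. all: by end_near. Qed.

Lemma nat_itv_cover (R : realType) (f : nat -> R) (t : R) :
  f k @[k --> \oo] --> +oo -> f 0 <= t -> exists k, f k <= t < f k.+1.
Proof.
move=> /cvgryPgt/(_ t)[N _ Nt] f0t.
have ex : exists k, t < f k.+1 by exists N; apply: Nt => /=.
exists (ex_minn ex); case: ex_minnP => k tk kmin; rewrite tk andbT.
case: k kmin {tk} => // k kmin; rewrite leNgt; apply/negP => /kmin.
by rewrite ltnn.
Qed.

(** * The pieces of one residue class, and the time changes as translations on them *)

Section Pieces.
Context (R : realType) (l : nat) (theta : int -> R).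
Hypothesis theta_lt : forall k : int, - (l.+1)%:Z <= k -> theta k < theta (k + 1).

(** Numbers the times from the index [- (l + 1)] on, so that natural indices suffice. *)
Definition theta_shift (n : nat) : R := theta (n%:Z - (l.+1)%:Z).

(* The pieces [a_k, b_k[ of Shat i and the matching pieces [u_k, u_k+1[ of the
   domain of alpha i; the piece of index 0 lies before theta 0. *)
Definition piece_l (i k : nat) : R := theta_shift (k * l.+1 + i)%N.
Definition piece_r (i k : nat) : R := theta_shift (k * l.+1 + i).+1.
Definition piece_u (i k : nat) : R :=
  if k is k'.+1 then vtheta l theta i k' else vtheta_m1 l theta i.
(** The translation by which [alpha] maps piece [k] of the glued time onto piece [k] of the original
    time. *)
Definition piece_d (i k : nat) : R := piece_l i k - piece_u i k.

Lemma theta_shift_incr : {homo theta_shift : m n / (m < n)%N >-> m < n}.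
Proof.
apply: homo_ltn => [y x z|n]; first exact: lt_trans.
rewrite /theta_shift (_ : n.+1%:Z - _ = n%:Z - (l.+1)%:Z + 1); last by lia.
by apply: theta_lt; lia.
Qed.

Lemma theta_shift_le m n : (m <= n)%N -> theta_shift m <= theta_shift n.
Proof.
by rewrite leq_eqVlt => /predU1P[->//|/theta_shift_incr/ltW].
Qed.

Lemma theta_natE n : theta n%:Z = theta_shift (n + l.+1).
Proof. by rewrite /theta_shift; congr theta; lia. Qed.

(** Piece [0] precedes [theta 0], whence the offset: block [k] of the original numbering is piece
    [k.+1]. *)
Lemma theta_idxE i (k : nat) : theta (idx l k%:Z i) = piece_l i k.+1.
Proof. by rewrite /piece_l /theta_shift /idx; congr theta; rewrite mulSn; lia. Qed.

Lemma theta_idxSE i (k : nat) : theta (idx l k%:Z i + 1) = piece_r i k.+1.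
Proof. by rewrite /piece_r /theta_shift /idx; congr theta; rewrite mulSn; lia. Qed.

Lemma theta_idxN1E i : theta (idx l (-1) i) = piece_l i 0.
Proof. by rewrite /piece_l /theta_shift /idx; congr theta; lia. Qed.

Lemma theta_idxN1SE i : theta (idx l (-1) i + 1) = piece_r i 0.
Proof. by rewrite /piece_r /theta_shift /idx; congr theta; lia. Qed.

Lemma theta_idx_predE i (k : nat) : theta (idx l (k%:Z - 1) i) = piece_l i k.
Proof. by rewrite /piece_l /theta_shift /idx; congr theta; lia. Qed.

Lemma theta_idx_predSE i (k : nat) : theta (idx l (k%:Z - 1) i + 1) = piece_r i k.
Proof. by rewrite /piece_r /theta_shift /idx; congr theta; lia. Qed.

Lemma piece_lr i k : piece_l i k < piece_r i k.
Proof. exact: theta_shift_incr. Qed.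

Lemma piece_rl i k m : (k < m)%N -> piece_r i k <= piece_l i m.
Proof. by move=> km; apply: theta_shift_le; nia. Qed.

Lemma piece_l_le i k m : (k <= m)%N -> piece_l i k <= piece_l i m.
Proof. by move=> km; apply: theta_shift_le; nia. Qed.

Lemma piece_uS i k : piece_u i k.+1 = piece_u i k + (piece_r i k - piece_l i k).
Proof.
case: k => [|k]; last by rewrite /= theta_idxSE theta_idxE.
by rewrite /= /vtheta_m1 theta_idxN1E theta_idxN1SE subrK.
Qed.

Lemma piece_dE i k : piece_u i k + piece_d i k = piece_l i k.
Proof. by rewrite /piece_d addrC subrK. Qed.

Lemma piece_dSE i k : piece_u i k.+1 + piece_d i k = piece_r i k.
Proof. by rewrite /piece_d piece_uS; ring. Qed.

Lemma piece_u_lt i k : piece_u i k < piece_u i k.+1.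
Proof. by rewrite piece_uS ltrDl subr_gt0 piece_lr. Qed.

Lemma piece_u_le i k m : (k <= m)%N -> piece_u i k <= piece_u i m.
Proof.
by apply: (homo_leq (f := piece_u i) (r := fun x y : R => x <= y)) => // [y x z|n];
  [exact: le_trans|exact/ltW/piece_u_lt].
Qed.

Lemma piece_u_leE i k m t : piece_u i k <= t < piece_u i k.+1 ->
  (piece_u i m <= t) = (m <= k)%N.
Proof.
move=> /andP[kt tk]; apply/idP/idP => [mt|/piece_u_le mk]; last exact: le_trans kt.
rewrite leqNgt; apply/negP => /(piece_u_le i) km.
by have := lt_le_trans tk (le_trans km mt); rewrite ltxx.
Qed.

Lemma piece_l_leE i k m t : piece_l i k <= t < piece_r i k ->
  (piece_l i m <= t) = (m <= k)%N.
Proof.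
move=> /andP[kt tk]; apply/idP/idP => [mt|/(piece_l_le i) mk]; last exact: le_trans kt.
rewrite leqNgt; apply/negP => /(piece_rl i) km.
by have := lt_le_trans tk (le_trans km mt); rewrite ltxx.
Qed.

Lemma piece_shift i k t :
  (piece_u i k <= t < piece_u i k.+1) =
  (piece_l i k <= t + piece_d i k < piece_r i k).
Proof. by rewrite -piece_dE -piece_dSE lerD2r ltrD2r. Qed.

(** Passing to the next piece of the class adds exactly the skipped gap to the translation. *)
Lemma piece_dS_sum i n : theta i%:Z - theta 0 + \sum_(1 <= j < n.+1)
    (theta (idx l j%:Z i) - theta (idx l (j%:Z - 1) i + 1)) = piece_d i n.+1.
Proof.
elim: n => [|n IH].
  rewrite big_geq// addr0 /piece_d /=; congr (_ - _).
  by rewrite -theta_idxE; congr theta; rewrite /idx; lia.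
rewrite big_nat_recr//= addrA IH theta_idxE theta_idx_predSE.
by rewrite -piece_dSE /piece_d; ring.
Qed.

Lemma alpha_piece i k t : piece_u i k <= t < piece_u i k.+1 ->
  alpha l theta i t = t + piece_d i k.
Proof.
move=> tk; rewrite /alpha.
(* Since [piece_u i 1] is [theta 0], the case test in [alpha] reads [1 <= k]. *)
have := piece_u_leE 1 tk; rewrite [piece_u i 1]/= => ->.
case: k tk => [|k] tk /=.
  rewrite theta_idxN1SE -(piece_dSE i 0) /=; ring.
rewrite -addrA; congr +%R.
rewrite -piece_dS_sum; congr +%R.
rewrite (fsbig_seq _ (r := index_iota 1 k.+1)) ?iota_uniq//.
apply: eq_fsbigl; apply/seteqP; split => j /=.
  rewrite mem_index_iota => -[j0 /andP[_]].
  by have := piece_u_leE j.+1 tk; rewrite /= => ->; lia.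
rewrite mem_index_iota => /andP[j0 jk]; split => //.
have := piece_u_leE j.+1 tk; rewrite /= => ->.
(* The condition [theta 0 < vtheta i j] holds for all [j >= 1], as the glued times increase strictly
   from [theta 0]. *)
rewrite ltnS -ltnS jk andbT; apply: lt_le_trans (piece_u_lt i 1) _.
exact: (@piece_u_le i 2 j.+1).
Qed.

Lemma S_P i t : S_ l theta i t <-> exists k, piece_l i k.+1 <= t < piece_r i k.+1.
Proof.
split=> [[k _]|[k]]; first by rewrite /= in_itv/= theta_idxE theta_idxSE; exists k.
by exists k => //=; rewrite in_itv/= theta_idxE theta_idxSE.
Qed.

Lemma Shat_P i t : Shat l theta i t <-> exists k, piece_l i k <= t < piece_r i k.
Proof.
split=> [[k _]|[k]].
  by rewrite /= in_itv/= theta_idx_predE theta_idx_predSE; exists k.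
by exists k => //=; rewrite in_itv/= theta_idx_predE theta_idx_predSE.
Qed.

(** A point determines the interval between consecutive times that contains it, hence
    [k * l.+1 + i]; Euclidean division by [l.+1] recovers [i] and [k]. *)
Lemma piece_inj i k i' k' t : (i <= l)%N -> (i' <= l)%N ->
  piece_l i k <= t < piece_r i k -> piece_l i' k' <= t < piece_r i' k' ->
  i = i' /\ k = k'.
Proof.
move=> il i'l /andP[t1 t2] /andP[t3 t4].
have E : (k * l.+1 + i = k' * l.+1 + i')%N.
  apply/eqP; rewrite eqn_leq; apply/andP; split; rewrite leqNgt; apply/negP.
    by move=> /theta_shift_le H; have := lt_le_trans t4 (le_trans H t1); rewrite ltxx.
  by move=> /theta_shift_le H; have := lt_le_trans t2 (le_trans H t3); rewrite ltxx.
have ii' : i = i' by have := congr1 (modn^~ l.+1) E; rewrite /= !modnMDl !modn_small.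
split=> //; move: E; rewrite ii' => /eqP; rewrite eqn_add2r eqn_mul2r /=.
by move=> /eqP.
Qed.

Lemma beta_piece i k t : (i <= l)%N -> piece_l i k <= t < piece_r i k ->
  beta l theta i t = t - piece_d i k.
Proof.
move=> il tk; rewrite /beta.
case: k tk => [|k] tk.
  (* Piece [0] is disjoint from [S_ i], so the second branch of [beta] applies. *)
  rewrite ifF; last first.
    apply/negbTE/negP; rewrite inE => /S_P[k /(piece_inj il il)/(_ tk)[]].
    by [].
  by rewrite theta_idxN1SE -(piece_dSE i 0) /=; ring.
rewrite ifT; last by rewrite inE; apply/S_P; exists k.
rewrite -piece_dS_sum; congr (_ - (_ + _)).
rewrite (fsbig_seq _ (r := index_iota 1 k.+1)) ?iota_uniq//.
apply: eq_fsbigl; apply/seteqP; split => j /=;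
  by rewrite mem_index_iota theta_idxE (piece_l_leE j.+1 tk) ltnS => /andP.
Qed.

Lemma vtheta_setE i k t : piece_u i k <= t < piece_u i k.+1 ->
  [set j | vtheta l theta i j <= t] = `I_k.
Proof.
by move=> tk; apply/seteqP; split => j /=;
  have := piece_u_leE j.+1 tk; rewrite /= => ->.
Qed.

Lemma theta_setE i k t : piece_l i k <= t < piece_r i k ->
  [set j : nat | theta (idx l j%:Z i) <= t] = `I_k.
Proof.
by move=> tk; apply/seteqP; split => j /=; rewrite theta_idxE (piece_l_leE j.+1 tk).
Qed.

(** As [vtheta i j] is the left end of piece [j.+1], the condition [s < vtheta i j <= t] means
    [m <= j < k]. *)
Lemma prod_vtheta i k m s t (F : nat -> R) :
  piece_u i m <= s < piece_u i m.+1 -> piece_u i k <= t < piece_u i k.+1 ->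
  \big[*%R/1]_(j \in [set j | s < vtheta l theta i j <= t]) F j =
  \prod_(m <= j < k) F j.
Proof.
move=> sm tk; rewrite (fsbig_seq _ (r := index_iota m k)) ?iota_uniq//.
apply: eq_fsbigl; apply/seteqP; split => j /=; rewrite mem_index_iota;
  have := piece_u_leE j.+1 tk; have := piece_u_leE j.+1 sm;
  by rewrite /= ltNge => -> ->; rewrite -ltnNge.
Qed.

Lemma chi_piece i k mu t : (i <= l)%N -> (mu <= l)%N ->
  piece_l i k <= t < piece_r i k -> chi l theta mu t = (mu == i)%:R.
Proof.
move=> il mul tk; rewrite /chi indicE; congr (nat_of_bool _)%:R.
apply/idP/eqP => [|->]; last by rewrite inE; apply/Shat_P; exists k.
by rewrite inE => /Shat_P[k' /(piece_inj mul il)/(_ tk)[]].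
Qed.

Lemma piece_u_cover i t : vtheta l theta i k @[k --> \oo] --> +oo ->
  vtheta_m1 l theta i <= t -> exists k, piece_u i k <= t < piece_u i k.+1.
Proof.
(* Shifting the index by one puts [vtheta_m1] in front without affecting divergence. *)
by move=> voo; apply: nat_itv_cover; rewrite -(cvg_shiftS (piece_u i)).
Qed.

Lemma theta_cover t : theta k%:Z @[k --> \oo] --> +oo -> theta 0 <= t ->
  exists i k, (i <= l)%N /\ piece_l i k.+1 <= t < piece_r i k.+1.
Proof.
move=> too t0; have [n] := nat_itv_cover too t0.
rewrite !theta_natE => nt; exists (n %% l.+1)%N, (n %/ l.+1)%N.
split; first by rewrite -ltnS ltn_mod.
rewrite /piece_l /piece_r mulSn -addnA -divn_eq.
by rewrite addnC; move: nt; rewrite addSn.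
Qed.
End Pieces.

Lemma prod_nat_split (R : comNzRingType) (m k : nat) (F : nat -> R) : (m <= k)%N ->
  \prod_(j < k) F j = \prod_(j < m) F j * \prod_(m <= j < k) F j.
Proof.
by move=> mk; rewrite -!(big_mkord xpredT) (big_cat_nat (leq0n m) mk).
Qed.

Lemma ae_neq (R : realType) (c : R) : \forall t \ae (@lebesgue_measure R), t != c.
Proof.
exists [set c]; split; [exact: measurable_set1|exact: lebesgue_measure_set1|].
by move=> t /= /negP; rewrite negbK => /eqP.
Qed.

(** * Positions of the impulses and of their delayed times among the pieces *)

Section Equivalence.
Context (R : realType) (l : nat) (theta : int -> R) (p tau : R -> R)
  (lambda : nat -> R) (phi : R -> R).
Hypothesis theta_lt : forall k : int, - (l.+1)%:Z <= k -> theta k < theta (k + 1).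
Hypothesis theta_rho : theta (- (l.+1)%:Z) = rho tau (theta 0).
Hypothesis tau_le : forall t, theta 0 <= t -> tau t <= t.
Hypothesis lambda_neq0 : forall k, lambda k != 0.

Local Notation a_ := (piece_l l theta).
Local Notation b_ := (piece_r l theta).
Local Notation u_ := (piece_u l theta).
Local Notation d_ := (piece_d l theta).

Lemma rho_le_piece_l i k : rho tau (theta 0) <= a_ i k.
Proof.
rewrite -theta_rho -[- _]sub0r; exact: (theta_shift_le theta_lt (leq0n _)).
Qed.

Lemma piece_r0_le i : (i <= l)%N -> b_ i 0 <= theta 0.
Proof. by move=> il; rewrite (theta_natE l); apply: (theta_shift_le theta_lt); lia. Qed.

Lemma theta0_le_piece_l i k : theta 0 <= a_ i k.+1.
Proof. by rewrite (theta_natE l); apply: (theta_shift_le theta_lt); lia. Qed.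

Lemma theta_piece_l i k : theta (k * l.+1 + i)%:Z = a_ i k.+1.
Proof. by rewrite (theta_natE l) /piece_l; congr theta_shift; lia. Qed.

Lemma thetaS_piece_r i k : theta ((k * l.+1 + i)%:Z + 1) = b_ i k.+1.
Proof.
by rewrite /piece_r /theta_shift; congr theta; lia.
Qed.

(** The impulse opening piece [k.+1] is driven by the left limit at the end of piece [k] of the same
    class, so it links exactly the two pieces that get glued. *)
Lemma theta_delayed i k : theta ((k * l.+1 + i)%:Z - l%:Z) = b_ i k.
Proof. by rewrite /piece_r /theta_shift; congr theta; lia. Qed.

(** * From a solution of (I) to solutions of (N_i) *)

Section ImpulsiveToContinuous.
Variables (x : R -> R) (i : nat) (y sigma : R -> R).
Hypothesis (i_le : (i <= l)%N).
Hypothesis vtheta_oo : vtheta l theta i k @[k --> \oo] --> +oo.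
Hypothesis sigma_cod : forall t, theta 0 <= t -> vtheta_m1 l theta i <= sigma t.
Hypothesis alpha_sigma : forall t, theta 0 <= t ->
  alpha l theta i (sigma t) = tau (alpha l theta i t).
Hypothesis phi_ac : abs_continuous `[rho tau (theta 0), theta 0] phi.
Hypothesis x_sol : is_solution_I l theta p tau lambda phi x.
Hypothesis y_def : forall t, vtheta_m1 l theta i <= t ->
  y t = (\big[*%R/1]_(j \in [set j : nat | vtheta l theta i j <= t])
           (1 / lambda (j * l.+1 + i)%N)) * x (alpha l theta i t).

Let E k := \prod_(j < k) (1 / lambda (j * l.+1 + i)%N).

Lemma y_piece k t : u_ i k <= t < u_ i k.+1 -> y t = E k * x (t + d_ i k).
Proof.
move=> tk; rewrite y_def; last first.
  by case/andP: tk => + _; apply: le_trans; exact: (@piece_u_le _ _ _ theta_lt i 0).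
by rewrite (fsbig_I _ (vtheta_setE theta_lt tk)) (alpha_piece theta_lt tk).
Qed.

Lemma x_piece0 t : a_ i 0 <= t < b_ i 0 -> x t = phi t.
Proof.
have [_ x_init _ _] := x_sol; move=> /andP[at_ tb]; apply: x_init.
by rewrite (le_trans (rho_le_piece_l i 0))// (lt_le_trans tb)// piece_r0_le.
Qed.

Lemma x_abs_continuous_piece k : abs_continuous `[a_ i k, b_ i k[ x.
Proof.
case: k => [|k]; last first.
  by have [/(_ (k * l.+1 + i)%N)[+ _ _]] := x_sol; rewrite theta_piece_l thetaS_piece_r.
apply: (abs_continuous_affine (c := 1) (d := 0)) phi_ac => t /=.
rewrite !in_itv/= => tab; rewrite mul1r addr0; split; last exact: x_piece0.
case/andP: tab => at_ tb.
by rewrite (le_trans (rho_le_piece_l i 0))// (le_trans (ltW tb))// piece_r0_le.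
Qed.

(** For a positive index the end of the piece is an impulse time, where the limit exists by
    definition of a solution. Piece [0] ends no later than [theta 0], and the limit comes from the
    continuity of [phi]. *)
Lemma x_cvg_left k : cvg (x @ (b_ i k)^'-).
Proof.
case: k => [|k]; last first.
  have [/(_ (k * l.+1 + i).+1)[_ + _] _ _ _] := x_sol.
  by rewrite -thetaS_piece_r (_ : _ + 1 = (k * l.+1 + i).+1%:Z)//; lia.
apply/cvg_ex; exists (phi (b_ i 0)).
rewrite -[phi _]mul1r; apply: (cvg_left_affine (f := phi) (d := 0) (piece_lr theta_lt i 0)).
  by move=> s /x_piece0; rewrite mul1r addr0.
rewrite addr0; apply: abs_continuous_cvg_left phi_ac; first exact: (piece_lr theta_lt i 0).
move=> t /=; rewrite !in_itv/= => /andP[at_ tb].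
by rewrite (le_trans (rho_le_piece_l i 0))// (le_trans tb)// piece_r0_le.
Qed.

Lemma x_jump_piece k :
  x (a_ i k.+1) = lambda (k * l.+1 + i)%N * lim (x @ (b_ i k)^'-).
Proof.
by have [_ _ _ /(_ (k * l.+1 + i)%N)] := x_sol; rewrite theta_piece_l theta_delayed.
Qed.

(* The factor 1 / lambda cancels the jump, so y is continuous at the time of
   the impulse. *)
Lemma y_cvg_left k : y s @[s --> (u_ i k.+1)^'-] --> y (u_ i k.+1).
Proof.
rewrite (@y_piece k.+1); last by rewrite lexx (piece_u_lt theta_lt).
have -> : E k.+1 * x (u_ i k.+1 + d_ i k.+1) = E k * lim (x @ (b_ i k)^'-).
  by rewrite piece_dE x_jump_piece /E big_ord_recr /=; field.
apply: (cvg_left_affine (d := d_ i k) (piece_u_lt theta_lt i k) (@y_piece k)).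
by rewrite piece_dSE; exact: x_cvg_left.
Qed.

(** The half-open piece comes from [x]; left continuity of [y] at its right end closes it. *)
Lemma y_abs_continuous_piece k : abs_continuous `[u_ i k, u_ i k.+1] y.
Proof.
apply: abs_continuous_closure (@y_cvg_left k); first exact: piece_u_lt.
apply: (abs_continuous_affine (c := E k) (d := d_ i k)) (x_abs_continuous_piece k).
move=> t /=.
rewrite !in_itv/= => tk; split; last exact: y_piece.
by rewrite -piece_shift.
Qed.

Lemma y_loc_abs_continuous : loc_abs_continuous `[vtheta_m1 l theta i, +oo[ y.
Proof.
move=> a b abD.
(* If [b] lies left of the domain, [[a, b]] must be empty; otherwise finitely many closed pieces are
   concatenated to cover it. *)
have [b0|b0] := ltP b (u_ i 0).
  apply: abs_continuousS (y_abs_continuous_piece 0) => t /= tab.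
  have := abD _ tab; rewrite /= !in_itv/= andbT => ut; move: tab.
  by rewrite in_itv/= => /andP[_ tb]; have := lt_le_trans b0 ut; rewrite ltNge tb.
have [k /andP[_ bk]] := piece_u_cover vtheta_oo b0.
have yk : abs_continuous `[u_ i 0, u_ i k.+1] y.
  elim: {bk}k => [|k IH]; first exact: y_abs_continuous_piece.
  apply: abs_continuous_concat IH (y_abs_continuous_piece k.+1).
    exact: piece_u_le.
  exact: piece_u_le.
apply: abs_continuousS yk => t /= tab; have := abD _ tab.
rewrite /= !in_itv/= andbT => -> /=; move: tab; rewrite in_itv/= => /andP[_ tb].
exact: le_trans tb (ltW bk).
Qed.

Lemma y_solution : is_solution_N l theta p lambda phi (fun=> sigma) i y.
Proof.
have [_ _ x_ode _] := x_sol.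
split; first exact: y_loc_abs_continuous.
(* The exceptional null set of [x] is translated by each of the countably many [d_ i k], and the
   points [u_ i k] are discarded as well. *)
- have H1 := ae_foralln (fun k => ae_translate (d_ i k) x_ode).
  have H2 := ae_foralln (fun k => ae_neq (u_ i k)).
  apply: filterS2 H1 H2 => t xt tu t0.
  have /(piece_u_cover vtheta_oo)[[|k] tk] : vtheta_m1 l theta i <= t.
  + by apply: le_trans t0; exact: (@piece_u_le _ _ _ theta_lt i 0 1).
  (* Piece [0] is excluded because it ends at [u_ i 1], which is [theta 0]. *)
  + by case/andP: tk => _ /(le_lt_trans t0); rewrite /= ltxx.
  have tk' := tk; rewrite (piece_shift _ _ i) in tk'.
  have [dx xode] := xt k.+1 (le_trans (theta0_le_piece_l i k) (andP tk').1).
  have ynear : \forall s \near t, y s = E k.+1 * x (s + d_ i k.+1).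
    exact: filterS (@y_piece k.+1) (near_itvco tk (tu k.+1)).
  have [dy ->] := derive1_affine ynear dx; split => //.
  have [m sm] := piece_u_cover vtheta_oo (sigma_cod t0).
  have as_ := alpha_sigma t0.
  rewrite (alpha_piece theta_lt sm) (alpha_piece theta_lt tk) in as_.
  (* As [tau] does not exceed the identity, the delayed time lies in the same or an earlier
     piece. *)
  have mk : (m <= k.+1)%N.
    rewrite -(piece_l_leE theta_lt m tk').
    have := tau_le (le_trans (theta0_le_piece_l i k) (andP tk').1).
    apply: le_trans; rewrite -as_.
    by move: sm; rewrite piece_shift => /andP[].
  rewrite (prod_vtheta theta_lt _ sm tk) (alpha_piece theta_lt tk) (y_piece sm) as_.
  (* [E k.+1] is [E m] times the coefficient product of (N_i). *)
  rewrite /E (prod_nat_split (fun j => 1 / lambda (j * l.+1 + i)%N) mk).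
  move/eqP : xode; rewrite addr_eq0 => /eqP ->.
  by ring.
- move=> t /andP[t0 t1].
  have t0' : u_ i 0 <= t < u_ i 1 by rewrite t0.
  rewrite (y_piece t0') /E big_ord0 mul1r (alpha_piece theta_lt t0').
  by apply: x_piece0; rewrite -piece_shift.
Qed.
End ImpulsiveToContinuous.

(** * From solutions of (N_i) to a solution of (I) *)

Section ContinuousToImpulsive.
Variables (x : R -> R) (y sigma : nat -> R -> R).
Hypothesis theta_oo : theta k%:Z @[k --> \oo] --> +oo.
Hypothesis S_tau : forall i, (i <= l)%N -> forall t, theta 0 <= t ->
  S_ l theta i t -> Shat l theta i (tau t).
Hypothesis sigma_beta : forall i, (i <= l)%N -> forall t, S_ l theta i t ->
  sigma i (beta l theta i t) = beta l theta i (tau t).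
Hypothesis y_sol : forall i, (i <= l)%N ->
  is_solution_N l theta p lambda phi sigma i (y i).
Hypothesis x_init : forall t, rho tau (theta 0) <= t < theta 0 -> x t = phi t.
Hypothesis x_def : forall t, theta 0 <= t ->
  x t = \sum_(mu < l.+1)
          chi l theta mu t
          * (\big[*%R/1]_(j \in [set j : nat | theta (idx l j%:Z mu) <= t])
               lambda (j * l.+1 + mu)%N)
          * y mu (beta l theta mu t).

Let D i k := \prod_(j < k) lambda (j * l.+1 + i)%N.

Lemma x_piece i k t : (i <= l)%N -> a_ i k <= t < b_ i k ->
  x t = D i k * y i (t - d_ i k).
Proof.
case: k => [|k] il tk.
  have tu : u_ i 0 <= t - d_ i 0 < u_ i 1 by rewrite piece_shift subrK.
  have [_ _ y_init] := y_sol il.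
  rewrite /D big_ord0 mul1r y_init// (alpha_piece theta_lt tu) subrK.
  apply: x_init; move/andP: tk => [at_ tb].
  by rewrite (le_trans (rho_le_piece_l i 0))// (lt_le_trans tb)// piece_r0_le.
have t0 : theta 0 <= t by case/andP: tk => + _; apply/le_trans/theta0_le_piece_l.
(* The classes are disjoint, so [chi] kills every term except [mu = i]. *)
rewrite x_def// (bigD1 (Ordinal (il : (i < l.+1)%N)))//= [X in _ + X]big1 ?addr0; last first.
  move=> mu mui; have mul : (mu <= l)%N by exact: ltn_ord mu.
  rewrite (chi_piece theta_lt il mul tk).
  by move: mui; rewrite -val_eqE /= => /negbTE ->; rewrite !mul0r.
rewrite (chi_piece theta_lt il il tk) eqxx mul1r.
by rewrite (fsbig_I _ (theta_setE theta_lt tk)) (beta_piece theta_lt il tk).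
Qed.

Lemma y_abs_continuous_itv i k : (i <= l)%N -> abs_continuous `[u_ i k, u_ i k.+1] (y i).
Proof.
move=> il; have [yac _ _] := y_sol il; apply: yac => t /=.
rewrite !in_itv/= andbT => /andP[+ _]; apply: le_trans.
exact: (@piece_u_le _ _ _ theta_lt i 0).
Qed.

Lemma x_cvg_piece_r i k : (i <= l)%N ->
  x s @[s --> (b_ i k)^'-] --> D i k * y i (u_ i k.+1).
Proof.
move=> il; apply: (cvg_left_affine (f := y i) (d := - d_ i k) (piece_lr theta_lt i k)).
  by move=> s /(x_piece il).
rewrite -piece_dSE addrK.
exact: (abs_continuous_cvg_left (piece_u_lt theta_lt i k) _ (y_abs_continuous_itv k il)).
Qed.

Lemma x_abs_continuous i k : (i <= l)%N -> abs_continuous `[a_ i k, b_ i k[ x.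
Proof.
move=> il.
apply: (abs_continuous_affine (c := D i k) (d := - d_ i k)) (y_abs_continuous_itv k il).
move=> t /=; rewrite !in_itv/= => tk; split; last exact: x_piece.
case/andP: tk => ? ?; rewrite lerBrDr lerBlDr piece_dE piece_dSE.
by apply/andP; split=> //; exact: ltW.
Qed.

Lemma x_solution : is_solution_I l theta p tau lambda phi x.
Proof.
(* Every impulse index is [k * l.+1 + i] with [i <= l], which reduces each claim to one class. *)
have nE n : n = (n %/ l.+1 * l.+1 + n %% l.+1)%N by exact: divn_eq.
have n_le n : (n %% l.+1 <= l)%N by rewrite -ltnS ltn_mod.
split => //.
- move=> n; split.
  + by rewrite (nE n) theta_piece_l thetaS_piece_r; exact: x_abs_continuous.
  (* [theta n] is the delayed time of the impulse [n + l], hence the right end of a piece. *)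
  + rewrite (_ : theta n = b_ ((n + l) %% l.+1) ((n + l) %/ l.+1)).
      apply/cvg_ex; eexists; exact: x_cvg_piece_r.
    by rewrite -theta_delayed -nE; congr theta; lia.
  + rewrite (nE n) theta_piece_l.
    exact: (abs_continuous_cvg_right (piece_lr theta_lt _ _) (@subset_refl _ _)
      (x_abs_continuous _ (n_le n))).
(* The bound [i <= l] sits inside the almost-everywhere statement, so that the countable
   intersection can run over all natural numbers [i]. *)
- have H1 i k : \forall t \ae (@lebesgue_measure R), (i <= l)%N ->
      theta 0 <= t - d_ i k -> derivable (y i) (t - d_ i k) 1 /\
        derive1 (y i) (t - d_ i k) +
        \big[*%R/1]_(j \in [set j : nat |
            sigma i (t - d_ i k) < vtheta l theta i j <= t - d_ i k])
          (1 / lambda (j * l.+1 + i)%N) * p (alpha l theta i (t - d_ i k))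
          * y i (sigma i (t - d_ i k)) = 0.
    have [il|il] := leqP i l; last exact: aeW.
    have [_ y_ode _] := y_sol il.
    have Hy := ae_translate (- d_ i k) y_ode.
    by apply: (negligibleS _ Hy) => t /= + Ht; apply => _; exact: Ht.
  have {}H1 := ae_foralln (fun i => ae_foralln (H1 i)).
  have H2 := ae_foralln (fun n : nat => ae_neq (theta n%:Z)).
  apply: filterS2 H1 H2 => t yt tn t0.
  have [i [k [il tk]]] := theta_cover l theta_oo t0.
  have tu : u_ i k.+1 <= t - d_ i k.+1 < u_ i k.+2 by rewrite piece_shift subrK.
  have u0 : theta 0 <= t - d_ i k.+1.
    by case/andP: tu => + _; apply: le_trans; exact: (@piece_u_le _ _ _ theta_lt i 1).
  have [dy yode] := yt i k.+1 il u0.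
  have ta : t != a_ i k.+1 by rewrite -theta_piece_l.
  have xnear : \forall s \near t, x s = D i k.+1 * y i (s + - d_ i k.+1).
    by apply: filterS (near_itvco tk ta) => s; exact: x_piece.
  have [dx ->] := derive1_affine xnear dy; split => //.
  have St : S_ l theta i t by apply/S_P; exists k.
  (* Invariance under [tau] keeps the delayed time in class [i], so [x] there is expressed by the
     same [y i]. *)
  have /Shat_P[m taum] := S_tau il t0 St.
  have mk : (m <= k.+1)%N.
    rewrite -(piece_l_leE theta_lt m tk).
    by case/andP: taum => + _; move/le_trans; apply; exact: tau_le.
  have taumu : u_ i m <= tau t - d_ i m < u_ i m.+1 by rewrite piece_shift subrK.
  have sigE : sigma i (t - d_ i k.+1) = tau t - d_ i m.
    by rewrite -(beta_piece theta_lt il tk) sigma_beta// (beta_piece theta_lt il taum).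
  move: yode; rewrite sigE (prod_vtheta theta_lt _ taumu tu) (alpha_piece theta_lt tu) subrK.
  move=> /eqP; rewrite addr_eq0 => /eqP ->.
  rewrite (x_piece il taum) /D (prod_nat_split (fun j => lambda (j * l.+1 + i)%N) mk).
  (* [P] is the ratio of the constants of the two pieces and [Q] the coefficient of (N_i); they
     cancel because no [lambda] vanishes. *)
  set P := \prod_(m <= j < k.+1) lambda _; set Q := \prod_(m <= j < k.+1) _.
  have PQ : P * Q = 1.
    by rewrite /P /Q -big_split big1//= => j _; rewrite mul1r mulfV.
  by rewrite -[X in p t * (X * _)]mulr1 -PQ; ring.
- move=> n; rewrite (nE n) theta_delayed theta_piece_l.
  move: (n %/ l.+1)%N (n %% l.+1)%N (n_le n) => k i il.
  (* Both sides evaluate [y i] at [u_ i k.+1], and [D i k.+1] is [D i k] times the factor of this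
     impulse. *)
  rewrite (cvg_lim _ (@x_cvg_piece_r i k il))//.
  rewrite (@x_piece i k.+1)//; last by rewrite lexx (piece_lr theta_lt).
  by rewrite -piece_dE addrK /D big_ord_recr /=; ring.
Qed.
End ContinuousToImpulsive.
End Equivalence.

Theorem theorem1 (R : realType) (l : nat) (theta : int -> R)
    (p tau : R -> R) (lambda : nat -> R)
    (theta_lt : forall k : int, - l%:Z <= k -> theta k < theta (k + 1))
    (theta_oo : theta k%:Z @[k --> \oo] --> +oo)
    (p_meas : lebesgue_measurable_fun `[theta 0, +oo[ p)
    (p_bnd : loc_ess_bounded `[theta 0, +oo[ p)
    (tau_meas : lebesgue_measurable_fun `[theta 0, +oo[ tau)
    (tau_le : forall t, theta 0 <= t -> tau t <= t)
    (tau_oo : tau t @[t --> +oo] --> +oo)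
    (lambda_neq0 : forall k, lambda k != 0)
    (rho_fin : forall t, theta 0 <= t -> has_lbound [set tau xi | xi in `[t, +oo[])
    (theta_rho : theta (- (l.+1)%:Z) = rho tau (theta 0))
    (rho_lt : rho tau (theta 0) < theta (- l%:Z))
    (vtheta_oo : forall i : nat, (i <= l)%N ->
       vtheta l theta i k @[k --> \oo] --> +oo)
    (S_tau : forall i : nat, (i <= l)%N -> forall t, theta 0 <= t ->
       (S_ l theta i t <-> Shat l theta i (tau t)))
    (sigma : nat -> R -> R)
    (sigma_cod : forall i : nat, (i <= l)%N -> forall t, theta 0 <= t ->
       vtheta_m1 l theta i <= sigma i t)
    (alpha_sigma : forall i : nat, (i <= l)%N -> forall t, theta 0 <= t ->
       alpha l theta i (sigma i t) = tau (alpha l theta i t))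
    (sigma_beta : forall i : nat, (i <= l)%N -> forall t, S_ l theta i t ->
       sigma i (beta l theta i t) = beta l theta i (tau t))
    (phi : R -> R)
    (phi_ac : abs_continuous `[rho tau (theta 0), theta 0] phi) :
  (forall x : R -> R, is_solution_I l theta p tau lambda phi x ->
     forall i : nat, (i <= l)%N ->
     forall y : R -> R,
       (forall t, vtheta_m1 l theta i <= t ->
          y t = (\big[*%R/1]_(j \in [set j : nat | vtheta l theta i j <= t])
                   (1 / lambda (j * l.+1 + i)%N))
                * x (alpha l theta i t)) ->
       is_solution_N l theta p lambda phi sigma i y)
  /\
  (forall y : nat -> R -> R,
     (forall i : nat, (i <= l)%N ->
        is_solution_N l theta p lambda phi sigma i (y i)) ->
     forall x : R -> R,
       (forall t, rho tau (theta 0) <= t < theta 0 -> x t = phi t) ->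
       (forall t, theta 0 <= t ->
          x t = \sum_(mu < l.+1)
                  chi l theta mu t
                  * (\big[*%R/1]_(j \in [set j : nat | theta (idx l j%:Z mu) <= t])
                       lambda (j * l.+1 + mu)%N)
                  * y mu (beta l theta mu t)) ->
       is_solution_I l theta p tau lambda phi x).
Proof.
(* Monotonicity is given from [- l] on; the step from [- (l + 1)] is [rho_lt], as [theta] there
   equals [rho tau (theta 0)]. *)
have theta_lt' (k : int) : - (l.+1)%:Z <= k -> theta k < theta (k + 1).
  move=> kl; have [kl'|kl'] := leP (- l%:Z) k; first exact: theta_lt.
  have -> : k = - (l.+1)%:Z by lia.
  by rewrite theta_rho (_ : _ + 1 = - l%:Z)//; lia.
split=> [x x_sol i il y y_def|y y_sol x x_init x_def].
- exact: (y_solution theta_lt' theta_rho tau_le lambda_neq0 il (vtheta_oo i il)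
    (sigma_cod i il) (alpha_sigma i il) phi_ac x_sol y_def).
- apply: (x_solution theta_lt' theta_rho tau_le lambda_neq0 theta_oo _ sigma_beta
    y_sol x_init x_def) => i il t t0.
  by move=> /(S_tau _ il _ t0).
Qed.
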